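(* Let $X$ and $Y$ be real, separable, reflexive Banach spaces with duals $X'$ and $Y'$. Assume that $X$ has a Schauder basis $(e_i)_{i\in\mathbb N}$ and that $X'$ is strictly convex. Let $A: X\to Y'$ be a (possibly nonlinear) operator which is weakly continuous and mapped coercive. Then for every $b\in Y'$ there exists $x\in X$ with $A(x)=b$.
   Context: $\langle\cdot,\cdot\rangle$ denotes the duality pairings ($Y'\times Y$ or $X'\times X$); $L(\cdot,\cdot)$ denotes bounded linear operators. For any finite dimensional subspace $Z\subset X$, $P_Z\in L(X,Z)$ denotes the natural projection induced by the Schauder basis; in particular, for $Z=\operatorname{span}(e_1,\dots,e_n)$ it is $P_Z\left(\sum_{i\ge1}x_ie_i\right)=\sum_{i=1}^n x_ie_i$. Weakly continuous means: whenever $x_n\rightharpoonup x$ weakly in $X$ (sequences), then $A(x_n)\stackrel{*}{\rightharpoonup}A(x)$ weakly-$*$ in $Y'$. Mapped coercive means: there exist a surjective $S\in L(X',Y)$ and a (possibly nonlinear) map $\Psi: X\to X'$ such that, with $\Phi:=S\circ\Psi$, $$\liminf_{x\in X,\ \|x\|_X\to\infty}\frac{\langle A(x),\Phi(x)\rangle}{\|x\|_X}=+\infty,$$ where $\Psi$ has the following three properties: (1) Boundedness: there is a constant $C_\Psi>0$ with $\|\Psi(x)\|_{X'}\le C_\Psi\|x\|_X$ for all $x\in X$. (2) Definiteness: $\langle\Psi(x),x\rangle>0$ for all $x\in X\setminus\{0\}$. (3) Projection property: for any finite dimensional subspace $Z\subset X$, $\langle\Psi(z),x-P_Zx\rangle=0$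 for all $z\in Z$ and all $x\in X$. *)

(* Defs.v *)
From HB Require Import structures.
From mathcomp Require Import all_boot all_order all_algebra finmap.
From mathcomp Require Import all_classical all_reals all_analysis.

Set Implicit Arguments.
Unset Strict Implicit.
Unset Printing Implicit Defensive.

Import Order.TTheory GRing.Theory Num.Theory.
Import numFieldNormedType.Exports.

Local Open Scope classical_set_scope.
Local Open Scope ring_scope.

Section DualSpace.
Context {R : realType} (X : normedModType R).

Definition dual_pred : {pred X -> R^o} :=
  [pred f | `[< linear f /\ continuous f >]].

Record dual : Type := Dual { dual_fun :> X -> R^o ; _ : dual_fun \in dual_pred }.

HB.instance Definition _ := [isSub for dual_fun].
HB.instance Definition _ := [Choice of dual by <:].

Lemma dual_pred_submod_closed : submod_closed dual_pred.
Proof.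
split=> [|a f g].
  apply: asboolT; split.
    by move=> k x y; rewrite [RHS]addr0 [RHS]scaler0.
  by move=> x; exact: cvg_cst.
move=> /asboolW[lf cf] /asboolW[lg cg]; apply: asboolT; split.
  move=> k x y; rewrite !fctE lf lg !scalerDr !scalerA (mulrC a k).
  by rewrite addrACA.
move=> x; apply: cvgD; last exact: cg.
by apply: cvgZr; exact: cf.
Qed.

HB.instance Definition _ :=
  GRing.isSubmodClosed.Build R (X -> R^o) dual_pred dual_pred_submod_closed.
HB.instance Definition _ := [SubChoice_isSubLmodule of dual by <:].

Lemma dual_funP (f : dual) : linear f /\ continuous f.
Proof. by case: f => f /= /asboolW. Qed.

Lemma dual_continuous (f : dual) : continuous f.
Proof. exact: (dual_funP f).2. Qed.

HB.instance Definition _ (f : dual) :=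
  GRing.isLinear.Build R X R^o _ (dual_fun f) (dual_funP f).1.

Lemma dual_eqP (f g : dual) : f = g <-> forall x, f x = g x.
Proof. by split=> [->//|fg]; apply/val_inj/funext. Qed.

Lemma dualDE (f g : dual) x : (f + g) x = f x + g x. Proof. by []. Qed.
Lemma dualZE a (f : dual) x : (a *: f) x = a * f x. Proof. by []. Qed.
Lemma dual0E x : (0 : dual) x = 0. Proof. by []. Qed.

Definition dual_norm (f : dual) : R := sup [set `|f x| | x in [set x | `|x| <= 1]].

Lemma dual_norm_has_sup (f : dual) :
  has_sup [set `|f x| | x in [set x | `|x| <= 1]].
Proof.
split; first by exists `|f 0|, 0 => //=; rewrite normr0.
have /linear_bounded_continuous/linear_boundedP/pinfty_ex_gt0[M M0 fM] :
  continuous (dual_fun f) by exact: dual_continuous.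
exists M => _ [x /= x1 <-]; apply: le_trans (fM x) _.
by rewrite ler_piMr// ltW.
Qed.

Lemma dual_normP (f : dual) x : `|f x| <= dual_norm f * `|x|.
Proof.
have [->|x0] := eqVneq x 0; first by rewrite linear0 !normr0 mulr0.
rewrite -ler_pdivrMr ?normr_gt0//; apply: ub_le_sup.
  exact: (dual_norm_has_sup f).2.
exists (`|x|^-1 *: x) => /=.
  by rewrite normrZ normfV normr_id mulVf ?normr_eq0.
by rewrite linearZ/= normrM normfV normr_id mulrC.
Qed.

Lemma dual_norm_le (f : dual) (M : R) :
  (forall x, `|x| <= 1 -> `|f x| <= M) -> dual_norm f <= M.
Proof.
move=> fM; apply: ge_sup; first exact: (dual_norm_has_sup f).1.
by move=> _ [x /= x1 <-]; exact: fM.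
Qed.

Lemma dual_norm_ge0 (f : dual) : 0 <= dual_norm f.
Proof.
apply: ub_le_sup; first exact: (dual_norm_has_sup f).2.
by exists 0 => /=; rewrite ?linear0 normr0.
Qed.

Lemma dual_norm_leD (f g : dual) : dual_norm (f + g) <= dual_norm f + dual_norm g.
Proof.
apply: dual_norm_le => x x1; rewrite dualDE (le_trans (ler_normD _ _))//.
by apply: lerD; apply: le_trans (dual_normP _ _) _; rewrite ler_piMr// dual_norm_ge0.
Qed.

Lemma dual_norm_leZ (a : R) (f : dual) : dual_norm (a *: f) <= `|a| * dual_norm f.
Proof.
apply: dual_norm_le => x x1; rewrite dualZE normrM ler_wpM2l//.
by apply: le_trans (dual_normP _ _) _; rewrite ler_piMr// dual_norm_ge0.
Qed.

Lemma dual_normZ (a : R) (f : dual) : dual_norm (a *: f) = `|a| * dual_norm f.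
Proof.
apply/eqP; rewrite eq_le dual_norm_leZ/=.
have [->|a0] := eqVneq a 0; first by rewrite normr0 mul0r dual_norm_ge0.
rewrite -ler_pdivlMl ?normr_gt0// -normfV.
by rewrite -{1}[f]scale1r -(mulVf a0) -scalerA dual_norm_leZ.
Qed.

Lemma dual_norm0_eq0 (f : dual) : dual_norm f = 0 -> f = 0.
Proof.
move=> f0; apply/dual_eqP => x; rewrite dual0E; apply/eqP.
by rewrite -normr_le0 (le_trans (dual_normP _ _))// f0 mul0r.
Qed.

HB.instance Definition _ :=
  Lmodule_isNormed.Build R dual dual_norm_leD dual_normZ dual_norm0_eq0.

Lemma dual_normE (f : dual) : `|f| = sup [set `|f x| | x in [set x | `|x| <= 1]].
Proof. by []. Qed.

End DualSpace.

Definition dual_pairing {R : realType} {X : normedModType R} (f : dual X) (x : X) : R :=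
  f x.

Section BanachNotions.
Context {R : realType}.

Section Bidual.
Context {X : normedModType R}.

Lemma bidual_subproof (x : X) :
  (fun f : dual X => dual_pairing f x : R^o) \in @dual_pred R (dual X).
Proof.
apply: asboolT.
have lin : linear (fun f : dual X => dual_pairing f x : R^o) by move=> a f g.
split=> // f; apply/(@cvgrPdist_le _ _ _ (nbhs f)) => e e0.
have M0 : 0 < `|x| + 1 by rewrite ltr_wpDl.
near=> g.
have -> : dual_pairing f x - dual_pairing g x = (f - g) x by [].
apply: le_trans (dual_normP _ _) _.
rewrite (@le_trans _ _ (`|f - g| * (`|x| + 1)))//.
  by rewrite ler_wpM2l// ?lerDl// dual_norm_ge0.
rewrite -ler_pdivlMr//; near: g.
by apply: cvgr_dist_le; rewrite // divr_gt0.
Unshelve. all: by end_near. Qed.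

Definition bidual_embedding (x : X) : dual (dual X) := Dual (bidual_subproof x).

End Bidual.

Definition reflexive_space (X : normedModType R) : Prop :=
  forall F : dual (dual X), exists x : X, bidual_embedding x = F.

Definition separable_space (T : topologicalType) : Prop :=
  exists2 D : set T, countable D & dense D.

Definition strictly_convex (V : normedModType R) : Prop :=
  forall (f g : V) (t : R), `|f| = 1 -> `|g| = 1 -> f != g -> 0 < t < 1 ->
    `|t *: f + (1 - t) *: g| < 1.

Definition weak_cvg {X : normedModType R} (u : nat -> X) (x : X) : Prop :=
  forall f : dual X, dual_pairing f (u n) @[n --> \oo] --> dual_pairing f x.

Definition weak_star_cvg {Y : normedModType R} (g : nat -> dual Y) (g0 : dual Y)
    : Prop :=
  forall y : Y, dual_pairing (g n) y @[n --> \oo] --> dual_pairing g0 y.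

Definition weakly_continuous {X Y : normedModType R} (A : X -> dual Y) : Prop :=
  forall (u : nat -> X) (x : X), weak_cvg u x -> weak_star_cvg (A \o u) (A x).

Section SchauderBasis.
Context {X : normedModType R}.
Implicit Types (e : nat -> X) (a : nat -> R) (F : {fset nat}).

Definition schauder_expansion e a (x : X) : Prop :=
  series (fun i => a i *: e i) n @[n --> \oo] --> x.

Definition schauder_basis e : Prop :=
  forall x, exists! a, schauder_expansion e a x.

Definition schauder_coord e (x : X) : nat -> R :=
  get [set a | schauder_expansion e a x].

(* A Schauder basis induces a projection exactly onto the finite dimensional
   subspaces spanned by finitely many basis vectors; span(e_1, ..., e_n) is the
   case of an initial segment F. *)
Definition schauder_span e F : set X :=
  [set \sum_(i <- F) a i *: e i | a in [set: nat -> R]].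

Definition schauder_proj e F (x : X) : X :=
  \sum_(i <- F) schauder_coord e x i *: e i.

End SchauderBasis.

Definition norm_to_infty {X : normedModType R} : set_system X :=
  [set V | \forall M \near +oo, forall x : X, M <= `|x| -> V x].

Record mapped_coercive_data {X Y : normedModType R} (e : nat -> X)
    (A : X -> dual Y) (S : {linear dual X -> Y}) (Psi : X -> dual X) : Prop := {
  S_continuous : continuous S ;
  S_surjective : forall y : Y, exists f : dual X, S f = y ;
  Phi_coercive :
    limf_einf (fun x => (dual_pairing (A x) (S (Psi x)) / `|x|)%:E) norm_to_infty = +oo%E ;
  Psi_bounded : exists2 C : R, 0 < C & forall x : X, `|Psi x| <= C * `|x| ;
  Psi_definite : forall x : X, x != 0 -> 0 < dual_pairing (Psi x) x ;
  Psi_projection : forall (F : {fset nat}) (z : X), schauder_span e F z ->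
    forall x : X, dual_pairing (Psi z) (x - schauder_proj e F x) = 0 }.

Definition mapped_coercive {X Y : normedModType R} (e : nat -> X)
    (A : X -> dual Y) : Prop :=
  exists (S : {linear dual X -> Y}) (Psi : X -> dual X),
    mapped_coercive_data e A S Psi.

End BanachNotions.

(* Main.v *)
Require Import Defs.
From mathcomp Require Import all_boot all_order all_algebra all_fingroup finmap.
From mathcomp Require Import all_classical all_reals all_analysis.
From mathcomp Require Import zify ring lra.

Set Implicit Arguments.
Unset Strict Implicit.
Unset Printing Implicit Defensive.

Import Order.TTheory GRing.Theory Num.Theory.
Import numFieldNormedType.Exports.

Local Open Scope classical_set_scope.
Local Open Scope ring_scope.

(** The proof is a Galerkin approximation followed by a weak limit, in which the
    map Psi supplies the test functionals.

    The projection property, applied to the line spanned by e_i, says that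
    Psi(e_i) is a positive multiple of the i-th coordinate functional e_i^*.
    Hence the coordinate functionals are continuous [coord_dualE], and Psi(z) is
    the combination of e_0^*, ..., e_n^* with coefficients <Psi(z), e_i>
    whenever z lies in the span Z_n of e_0, ..., e_n [Psi_coord_dual].

    Galerkin step [galerkin_solution].  Look for x in Z_n such that
    <A(x) - b, S e_i^*> = 0 for all i <= n; these are n+1 continuous equations
    G(v) = 0 in the n+1 coordinates v of x.  Weighted with the coefficients of
    Psi(x), the components of G add up to <A(x) - b, Phi(x)>, which is positive
    as soon as the norm of x reaches a radius rho independent of n
    [coercive_radius]; weighted in the same way, the components of v itself add
    up to <Psi(x), x> > 0.  So on the sphere of radius rho the vector G(v) is
    never a nonpositive multiple of v, and Brouwer's theorem gives a zero of G
    in the ball [outward_field_zero].  Psi enters only to exclude a direction,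
    which is why it may be discontinuous.

    Limit [reflexive_weak_subsequence].  A bounded sequence in a reflexive space
    converges weakly along every ultrafilter, because the limits of its images
    under functionals define an element of the bidual.  As the functionals e_i^*
    separate points and are countably many, this yields an honest weakly
    convergent subsequence of the Galerkin solutions.  Weak continuity of A
    then gives <A(x) - b, S e_i^*> = 0 for all i.  The functional
    f |-> <A(x) - b, S f> on X' is evaluation at some x0 in X by reflexivity;
    all coordinates of x0 vanish, so x0 = 0, and surjectivity of S gives
    A(x) = b.

    Brouwer's theorem [brouwer_bounded] is derived from Kuhn's cubical version
    of Sperner's lemma [kuhn_lemma], which is proved by a discrete mapping
    degree: for integer labels l_1, ..., l_n on a grid, the sum over all
    simplices of the Freudenthal triangulation of n! times the signed volumes of
    their images under l is the same for all labels such that each l_i is 0 on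
    the side v_i = 0 of the grid and 1 on the opposite side [degree_admissible],
    by a discrete Stokes formula [det_affine_stokes].  For one explicit
    labelling the sum is n!, so for every such labelling some simplex has a
    nondegenerate image. *)

(** * A discrete mapping degree and Kuhn's lemma *)

Section DiscreteDegree.
Variable n : nat.
Implicit Types (p : nat) (v : 'I_n.+1 -> nat) (k : 'I_n.+1).

Definition label : Type := 'I_n.+1 -> ('I_n.+1 -> nat) -> int.

(** Vertex j of the simplex of the Freudenthal triangulation with least corner x:
    going from vertex j to vertex j+1 raises the coordinate r with s r = j.  Thus
    s sends a coordinate to its position in the order of raising, not
    conversely. *)
Definition kuhn_vertex p (x : {ffun 'I_n.+1 -> 'I_p}) (s : 'S_n.+1) (j : nat) :
    'I_n.+1 -> nat :=
  fun r => (x r + (s r < j))%N.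

(** With the extra row of ones, the determinant of [affine_mx l w] is (n+1)!
    times the signed volume of the simplex spanned by the points l (w j). *)
Definition affine_row (l : label) (a : 'I_n.+2) v : int :=
  if unlift ord0 a is Some r then l r v else 1.

Definition affine_mx (l : label) (w : 'I_n.+2 -> 'I_n.+1 -> nat) : 'M[int]_n.+2 :=
  \matrix_(a, j) affine_row l a (w j).

Definition kuhn_mx (l : label) p (x : {ffun 'I_n.+1 -> 'I_p}) (s : 'S_n.+1) :=
  affine_mx l (fun j => kuhn_vertex x s j).

Definition degree (l : label) p : int :=
  \sum_(x : {ffun 'I_n.+1 -> 'I_p}) \sum_(s : 'S_n.+1)
    (-1) ^+ s * \det (kuhn_mx l x s).

(** A primitive of the volume form: up to sign, (n+1)! times the integral, over
    the face with vertices u, of l_k times the product of the dl_i for i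
    different from k, each label being extended affinely to the face. *)
Definition face_val (l : label) k (u : 'I_n.+1 -> 'I_n.+1 -> nat) : int :=
  (\sum_i l k (u i)) *
  \det (\matrix_(a, i) affine_row l (lift (lift ord0 k) a) (u i)).

(** Expand along the row of l_k.  The cofactors of that row add up to zero
    (replacing the row by ones gives two equal rows), so the entry l_k (w j) may
    be replaced by minus the sum of the other entries of the row; then the term
    of index j depends only on the face opposite to vertex j. *)
Lemma det_affine_stokes (l : label) k (w : 'I_n.+2 -> 'I_n.+1 -> nat) :
  \det (affine_mx l w) =
  - \sum_(j < n.+2) (-1) ^+ (k.+1 + j) * face_val l k (fun i => w (lift j i)).
Proof.
set M := affine_mx l w; set K : 'I_n.+2 := lift ord0 k.
pose S := \sum_j l k (w j).
have MK j : M K j = l k (w j) by rewrite mxE /affine_row liftK.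
have cof0 : \sum_j cofactor M K j = 0.
  pose B : 'M[int]_n.+2 := \matrix_(a, j) if a == K then 1 else M a j.
  have alt : B K =1 B ord0.
    by move=> j; rewrite !mxE eqxx /affine_row unlift_none; case: eqVneq.
  have K0 : K != ord0 by rewrite eq_sym neq_lift.
  rewrite -[RHS](determinant_alternate K0 alt) (expand_det_row _ K).
  apply: eq_bigr => j _; rewrite mxE eqxx mul1r /cofactor; congr (_ * \det _).
  by apply/matrixP => a i; rewrite !mxE eq_sym (negbTE (neq_lift _ _)).
have face (j : 'I_n.+2) : face_val l k (fun i => w (lift j i)) =
    (S - M K j) * \det (row' K (col' j M)).
  rewrite /S (bigD1_ord j)//= MK addrAC subrr add0r; congr (_ * \det _).
  by apply/matrixP => a i; rewrite !mxE.
rewrite (expand_det_row _ K); transitivity (\sum_j (M K j - S) * cofactor M K j).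
  under [RHS]eq_bigr do rewrite mulrBl.
  by rewrite sumrB -mulr_sumr cof0 mulr0 subr0.
rewrite -[RHS]sumrN; apply: eq_bigr => j _.
by rewrite face /cofactor mulrCA -[M K j - S]opprB mulNr mulrN.
Qed.

Definition admissible p (l : label) := forall k v,
  (v k = 0%N -> l k v = 0) /\ (v k = p -> l k v = 1).

(** On a side of the cube orthogonal to the direction r, either l_k vanishes
    (r = k), or the row of l_r is constant on the face, hence proportional to
    the row of ones. *)
Lemma face_val_boundary (l : label) k p (u : 'I_n.+1 -> 'I_n.+1 -> nat) r
    (c : bool) :
  (forall i v, i != k -> (v i = 0%N -> l i v = 0) /\ (v i = p -> l i v = 1)) ->
  (forall v, v k = 0%N \/ v k = p -> l k v = 0) ->
  (forall i, u i r = if c then p else 0%N) ->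
  face_val l k u = 0.
Proof.
move=> lP lk ur; rewrite /face_val.
have [rk|rk] := eqVneq r k.
  rewrite big1 ?mul0r// => i _; apply: lk; rewrite -rk ur.
  by case: (c); [right|left].
set N := (X in \det X).
have [a0 a0E _] := @unlift_some _ (lift ord0 k) ord0 isT.
have /unlift_some[ar arE _] : lift ord0 k != lift ord0 r.
  by rewrite (inj_eq lift_inj) eq_sym.
have Nr i : N ar i = c%:R.
  rewrite mxE -arE /affine_row liftK.
  have := ur i; case: (c) => /= h; first by rewrite (lP _ _ rk).2.
  by rewrite (lP _ _ rk).1.
rewrite (_ : \det N = 0) ?mulr0//; case: c {ur} Nr => Nr.
  apply: (@determinant_alternate _ _ _ a0 ar).
    apply/eqP => a0r; move: arE; rewrite -a0r -a0E => /eqP.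
    by rewrite eq_sym (negbTE (neq_lift _ _)).
  by move=> i; rewrite Nr mxE -a0E /affine_row unlift_none.
by rewrite (expand_det_row _ ar) big1// => i _; rewrite Nr mul0r.
Qed.

Definition face_sum (l : label) k p (j : 'I_n.+2) : int :=
  \sum_(x : {ffun 'I_n.+1 -> 'I_p}) \sum_(s : 'S_n.+1)
    (-1) ^+ s * face_val l k (fun i => kuhn_vertex x s (lift j i)).

(** Exchanging the steps j-1 and j of a simplex moves only its vertex j: the two
    simplices on both sides of this face cancel. *)
Lemma face_sum_interior (l : label) k p (j : 'I_n.+2) :
  (0 < j < n.+1)%N -> face_sum l k p j = 0.
Proof.
move=> /andP[j0 jn].
have j1n : (j.-1 < n.+1)%N by rewrite (leq_ltn_trans (leq_pred _)).
pose t : 'S_n.+1 := tperm (Ordinal j1n) (Ordinal jn).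
have odd_t : odd_perm t by rewrite odd_tperm -val_eqE/=; lia.
suff : face_sum l k p j = - face_sum l k p j by lia.
rewrite {1}/face_sum -[RHS]sumrN; apply: eq_bigr => x _.
rewrite [LHS](reindex_inj (mulIg t)) -[RHS]sumrN; apply: eq_bigr => s _ /=.
rewrite odd_permM odd_t addbT signrN mulNr; congr (- (_ * _)); congr face_val.
apply: funext => i; apply: funext => r; rewrite /kuhn_vertex permM /t.
congr (_ + _)%N.
by case: tpermP => // sr; rewrite ?sr /= /bump; lia.
Qed.

(** The face opposite to vertex 0 is the face opposite to the last vertex of the
    neighbour, whose least corner is vertex 1 and whose first step becomes the
    last one; this rotation has sign (-1)^n.  At the side of the cube there is no
    neighbour, but both faces contribute zero there, which allows moving the
    corner cyclically and thus pairing all simplices by a bijection. *)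
Lemma face_sum_extreme (l : label) k p :
  (forall i v, i != k -> (v i = 0%N -> l i v = 0) /\ (v i = p -> l i v = 1)) ->
  (forall v, v k = 0%N \/ v k = p -> l k v = 0) ->
  face_sum l k p ord0 = (-1) ^+ n * face_sum l k p ord_max.
Proof.
move=> lP lk.
pose c : 'S_n.+1 := lift_perm ord0 ord_max 1.
have c_odd : odd_perm c = odd n by rewrite odd_lift_perm odd_perm1 addbF.
pose h (xs : {ffun 'I_n.+1 -> 'I_p} * 'S_n.+1) :=
  ([ffun r => if xs.2 r == ord0 then ordS (xs.1 r) else xs.1 r], (xs.2 * c)%g).
have h_inj : injective h.
  move=> [x s] [y u] [/ffunP xy /mulIg su]; rewrite -{u}su in xy *.
  congr (_, _); apply/ffunP => r; have := xy r; rewrite !ffunE /=.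
  by case: ifP => // _; exact: ordS_inj.
rewrite /face_sum !pair_bigA/= [in RHS](reindex_inj h_inj) mulr_sumr.
apply: eq_bigr => -[x s] _ /=; rewrite odd_permM c_odd signr_addb signr_odd.
rewrite -mulrA [RHS]mulrCA; congr (_ * _); rewrite mulrA -expr2 sqrr_sign mul1r.
pose r0 := (s^-1 ord0)%g; have sr0 : s r0 = ord0 by rewrite permKV.
have cE r : (c (s r) : nat) = if s r == ord0 then n else (s r).-1.
  rewrite /c; case: (unliftP ord0 (s r)) => [j|] ->.
    by rewrite lift_perm_lift perm1 lift_max /=.
  by rewrite lift_perm_id eqxx.
have [xp|xp] := eqVneq (x r0).+1 p.
  rewrite (@face_val_boundary _ _ p _ r0 true)//; last first.
    by move=> i; rewrite /kuhn_vertex sr0 /= addn1.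
  rewrite (@face_val_boundary _ _ p _ r0 false)// => i.
  rewrite /kuhn_vertex ffunE permM cE sr0 eqxx /= xp modnn /bump.
  by have := ltn_ord i; lia.
congr face_val; apply: funext => i; apply: funext => r.
rewrite /kuhn_vertex ffunE permM cE /= /bump.
have [sr|sr] := eqVneq (s r) ord0.
  have -> : r = r0 by apply: (@perm_inj _ s); rewrite sr0.
  rewrite sr0 /= modn_small; last by have := ltn_ord (x r0); lia.
  by have := ltn_ord i; lia.
by have : s r != 0%N :> nat := sr; have := ltn_ord i; lia.
Qed.

Lemma degree_boundary (l : label) k p :
  (forall i v, i != k -> (v i = 0%N -> l i v = 0) /\ (v i = p -> l i v = 1)) ->
  (forall v, v k = 0%N \/ v k = p -> l k v = 0) ->
  degree l p = 0.
Proof.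
move=> lP lk.
transitivity (- \sum_(j < n.+2) (-1) ^+ (k.+1 + j) * face_sum l k p j).
  rewrite /face_sum /degree.
  under [in RHS]eq_bigr do rewrite mulr_sumr.
  rewrite [in RHS]exchange_big -[RHS]sumrN; apply: eq_bigr => x _ /=.
  under [in RHS]eq_bigr do rewrite mulr_sumr.
  rewrite [in RHS]exchange_big -[RHS]sumrN; apply: eq_bigr => s _ /=.
  rewrite (det_affine_stokes l k) mulrN mulr_sumr; congr (- _).
  by apply: eq_bigr => j _; rewrite mulrCA.
rewrite big_ord_recl big_ord_recr /= big1 => [|i _]; last first.
  by rewrite face_sum_interior ?mulr0//= /bump; have := ltn_ord i; lia.
rewrite add0r (face_sum_extreme lP lk) (_ : lift ord0 ord_max = ord_max).
  rewrite /bump /= addn0 mulrA -exprD add1n addnS exprS mulN1r mulNr.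
  by rewrite subrr oppr0.
exact: val_inj.
Qed.

Lemma degree_change1 (l l' : label) k p :
  admissible p l -> admissible p l' -> (forall i, i != k -> l i = l' i) ->
  degree l p = degree l' p.
Proof.
move=> lP lP' ll'.
pose m : label := fun i v => if i == k then l k v - l' k v else l i v.
have : degree m p = 0.
  apply: (@degree_boundary _ k) => [i v ik|v vk]; rewrite /m ?(negbTE ik) ?eqxx.
    exact: lP.
  case: vk => vk; first by rewrite (lP k v).1// (lP' k v).1// subr0.
  by rewrite (lP k v).2// (lP' k v).2// subrr.
suff -> : degree m p = degree l p - degree l' p by move/subr0_eq.
rewrite /degree -sumrB; apply: eq_bigr => x _; rewrite -sumrB; apply: eq_bigr => s _.
rewrite -mulrBr; congr (_ * _).
rewrite (@determinant_multilinear _ _ (kuhn_mx m x s) (kuhn_mx l x s)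
  (kuhn_mx l' x s) (lift ord0 k) 1 (-1)) ?mul1r ?mulN1r//.
- by apply/rowP => j; rewrite !mxE /affine_row liftK /m eqxx mul1r mulN1r.
- apply/matrixP => a j; rewrite !mxE /affine_row /m.
  case: unliftP => // i ai; case: eqVneq => // ik.
  by have := neq_lift (lift ord0 k) a; rewrite ai ik eqxx.
- apply/matrixP => a j; rewrite !mxE /affine_row /m.
  case: unliftP => // i ai; case: eqVneq => ik; last by rewrite ll'.
  by have := neq_lift (lift ord0 k) a; rewrite ai ik eqxx.
Qed.

(** Change the labels l_k one at a time. *)
Lemma degree_admissible (l l' : label) p :
  admissible p l -> admissible p l' -> degree l p = degree l' p.
Proof.
move=> lP lP'.
pose hyb (t : nat) : label := fun i v => if (i < t)%N then l' i v else l i v.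
have hybP t : admissible p (hyb t).
  by move=> i v; rewrite /hyb; case: ifP => _; [exact: lP'|exact: lP].
have step t : (t <= n.+1)%N -> degree l p = degree (hyb t) p.
  elim: t => [|t IH] tn; first by congr degree.
  rewrite IH ?(ltnW tn)//; apply: (@degree_change1 _ _ (Ordinal tn)) => // i it.
  apply: funext => v; rewrite /hyb ltnS [in RHS]leq_eqVlt -val_eqE/= in it *.
  by rewrite (negbTE it).
rewrite (step n.+1)//; congr degree; apply: funext => i; apply: funext => v.
by rewrite /hyb ltn_ord.
Qed.

(** For the labels l_i (v) = [v_i > 0] only the simplices at the corner 0 count:
    elsewhere some row consists of ones.  At this corner the matrix of s is a
    row permutation by s of a unitriangular matrix, so each s contributes 1. *)
Lemma degree_admissible_neq0 (l : label) p :
  (0 < p)%N -> admissible p l -> degree l p != 0.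
Proof.
move=> p0 lP; pose l0 : label := fun i v => (0 < v i)%N%:R.
rewrite (@degree_admissible l l0)//; last first.
  by move=> i v; rewrite /l0; split=> ->//; rewrite p0.
pose x0 : {ffun 'I_n.+1 -> 'I_p} := [ffun=> Ordinal p0].
rewrite /degree (bigD1 x0)//= [X in _ + X]big1 => [|x xx0]; last first.
  have [r xr] : exists r, (0 < x r)%N.
    apply/existsP; apply: contraR xx0 => /existsPn x0r.
    by apply/eqP/ffunP => r; apply/val_inj; rewrite ffunE /=; have := x0r r; lia.
  apply: big1 => s _.
  rewrite (@determinant_alternate _ _ _ ord0 (lift ord0 r)) ?mulr0//.
  by move=> j; rewrite !mxE /affine_row unlift_none liftK /l0 /kuhn_vertex ltn_addr.
rewrite addr0.
pose U : 'M[int]_n.+2 := \matrix_(a, j) (a <= j)%N%:R.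
have detU : \det U = 1.
  rewrite -det_tr det_trig; first by rewrite big1// => i _; rewrite !mxE leqnn.
  by apply/is_trig_mxP => i j ij; rewrite !mxE leqNgt ij.
rewrite (eq_bigr (fun=> 1)) => [|s _]; last first.
  rewrite (_ : kuhn_mx _ _ _ = row_perm (lift_perm ord0 ord0 s) U).
    rewrite row_permE det_mulmx det_perm detU mulr1 odd_lift_perm /=.
    by rewrite -signr_addb addbb.
  apply/matrixP => a j; rewrite !mxE /affine_row; case: (unliftP ord0 a) => [r|] ->.
    by rewrite lift_perm_lift /l0 /kuhn_vertex ffunE /= add0n lt0b.
  by rewrite lift_perm_id.
by rewrite sumr_const card_Sn pnatr_eq0 -lt0n fact_gt0.
Qed.

(** A simplex with nonzero determinant has no label that is constant on its
    vertices, since such a row would be zero or equal to the row of ones. *)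
Lemma kuhn_lemma p (L : 'I_n.+1 -> ('I_n.+1 -> nat) -> bool) : (0 < p)%N ->
  (forall i v, v i = 0%N -> L i v = false) ->
  (forall i v, v i = p -> L i v = true) ->
  exists x : 'I_n.+1 -> nat, (forall i, x i < p)%N /\
    forall i, exists v w,
      [/\ forall r, (x r <= v r <= (x r).+1)%N,
          forall r, (x r <= w r <= (x r).+1)%N,
          L i v = true & L i w = false].
Proof.
move=> p0 L0 Lp; pose l : label := fun i v => (L i v)%:R.
have lP : admissible p l by move=> i v; rewrite /l; split=> [/L0|/Lp] ->.
have [x [s det0]] : exists x s, \det (@kuhn_mx l p x s) != 0.
  apply: contrapT => h; have := degree_admissible_neq0 p0 lP.
  rewrite /degree big1 ?eqxx// => x _; rewrite big1// => s _.
  have [->|d0] := eqVneq (\det (kuhn_mx l x s)) 0; first by rewrite mulr0.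
  by exfalso; apply: h; exists x, s.
have cell j r : (x r <= kuhn_vertex x s j r <= (x r).+1)%N.
  by rewrite /kuhn_vertex; case: (_ < _)%N; lia.
exists (fun i => x i); split=> // i.
have /existsP[jt Ljt] : [exists j : 'I_n.+2, L i (kuhn_vertex x s j)].
  apply: contraNT det0 => /existsPn Lf; apply/eqP.
  rewrite (expand_det_row _ (lift ord0 i)) big1// => j _.
  by rewrite !mxE /affine_row liftK /l (negbTE (Lf j)) mul0r.
have /existsP[jf Ljf] : [exists j : 'I_n.+2, ~~ L i (kuhn_vertex x s j)].
  apply: contraNT det0 => /existsPn Lt; apply/eqP.
  apply: (@determinant_alternate _ _ _ ord0 (lift ord0 i)) => [|j].
    by rewrite neq_lift.
  rewrite !mxE /affine_row unlift_none liftK /l.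
  by have := Lt j; rewrite negbK => ->.
exists (kuhn_vertex x s jt), (kuhn_vertex x s jf); split=> //.
exact: negbTE.
Qed.

End DiscreteDegree.

(** * Brouwer's fixed point theorem *)

Section Brouwer.
Variables (R : realType) (n : nat).
Implicit Types F : 'rV[R]_n.+1 -> 'rV[R]_n.+1.

(** Divide the cube of half-width M into N+1 slices in each direction and label
    a grid point by the sign of the displacement F - id, with the labels forced
    on the sides of the cube, where the sign is known because F takes its values
    in the cube. *)
Lemma approximate_fixed_point F (M : R) (N : nat) : 0 < M ->
  (forall xi i, `|F xi 0 i| <= M) ->
  exists z : 'rV[R]_n.+1, (forall i, `|z 0 i| <= M) /\
    forall i, exists u w : 'rV[R]_n.+1,
      [/\ forall r, `|z 0 r - u 0 r| <= 2 * M / N.+1%:R,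
          forall r, `|z 0 r - w 0 r| <= 2 * M / N.+1%:R,
          F u 0 i <= u 0 i & w 0 i <= F w 0 i].
Proof.
move=> M0 FM; pose c : R := 2 * M / N.+1%:R.
have c0 : 0 <= c by rewrite divr_ge0// mulr_ge0// ltW.
have cN : c * N.+1%:R = 2 * M by rewrite divfK.
pose g (v : 'I_n.+1 -> nat) : 'rV[R]_n.+1 := \row_i (c * (v i)%:R - M).
pose L i v := (v i == N.+1) || ((0 < v i)%N && (F (g v) 0 i <= g v 0 i)).
have L0 i v : v i = 0%N -> L i v = false by move=> vi; rewrite /L vi.
have Lp i v : v i = N.+1 -> L i v = true by move=> vi; rewrite /L vi eqxx.
have [x [xN xL]] := kuhn_lemma (ltn0Sn N) L0 Lp.
have gE v i : v i = N.+1 -> g v 0 i = M.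
  by move=> vi; rewrite mxE vi cN; lra.
have close v r : (x r <= v r <= (x r).+1)%N -> `|g x 0 r - g v 0 r| <= c.
  move=> xv; rewrite !mxE opprD addrACA subrr addr0 -mulrBr normrM (ger0_norm c0).
  rewrite ler_piMr//.
  have [->|->] : v r = x r \/ v r = (x r).+1 by lia.
    by rewrite subrr normr0.
  by rewrite -addn1 natrD opprD addNKr normrN normr1.
exists (g x); split=> [i|i].
  have xi : (x i)%:R <= N.+1%:R :> R by rewrite ler_nat ltnW.
  rewrite mxE ler_norml lerBlDr lerBrDr; apply/andP; split.
    by rewrite addNr mulr_ge0.
  by rewrite (le_trans (ler_wpM2l c0 xi))// cN; lra.
have [v [w [xv xw Lv Lw]]] := xL i; exists (g v), (g w); split.
- by move=> r; exact: close.
- by move=> r; exact: close.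
- move: Lv; rewrite /L => /orP[/eqP vi|/andP[_ //]].
  by rewrite gE// (le_trans (ler_norm _))// FM.
- move: Lw; rewrite /L => /negbT; rewrite negb_or negb_and -leqNgt leqn0 => /andP[_].
  case/orP => [/eqP wi|]; last by rewrite -ltNge => /ltW.
  rewrite [leLHS]mxE wi mulr0 sub0r.
  by have := FM (g w) i; rewrite ler_norml => /andP[].
Qed.

(** A cluster point of the approximations z_N is fixed: arbitrarily close to it
    each component of the displacement F - id takes both weak signs. *)
Theorem brouwer_bounded F (M : R) : continuous F ->
  (forall xi i, `|F xi 0 i| <= M) -> exists xi, F xi = xi.
Proof.
move=> cF FM0.
(* The cube must have positive width even if M = 0. *)
pose B := M + 1.
have B0 : 0 < B by rewrite ltr_wpDl// (le_trans _ (FM0 0 ord0)).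
have FM xi i : `|F xi 0 i| <= B by rewrite (le_trans (FM0 _ _))// lerDl.
have [z zP] := choice (fun N => approximate_fixed_point N B0 FM).
have zB N i : `|z N 0 i| <= B by have [] := zP N.
have cpt := @rV_compact R n.+1 (fun=> `[-B, B]%classic)
  (fun=> @segment_compact R (-B) B).
have [|xi [_ zxi]] := cpt (z @ \oo) (fmap_proper_filter z eventually_filter).
  by exists 0%N => // N _ i /=; rewrite in_itv/= -ler_norml.
have near_xi (e : R) : 0 < e -> exists N,
    (forall r, `|xi 0 r - z N 0 r| < e) /\ 2 * B / N.+1%:R < e.
  move=> e0.
  have : (z @ \oo) [set z N | N in [set N | 2 * B / N.+1%:R < e]].
    exists (Num.truncn (2 * B / e)) => // N /= eN; exists N => //=.
    rewrite ltr_pdivrMr// [ltRHS]mulrC -ltr_pdivrMr//.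
    by rewrite (lt_le_trans (truncnS_gt _))// ler_nat.
  move=> /zxi /(_ (nbhsx_ballx xi e e0)) [_ [[N Ne <-] [_ xiz]]].
  by exists N; split=> // r; exact: xiz.
exists xi; apply/rowP => i.
pose d (y : 'rV[R]_n.+1) : R := F y 0 i - y 0 i.
have cFi y : F v 0 i @[v --> y] --> F y 0 i.
  exact: (cvg_comp F (fun v : 'rV[R]_n.+1 => v 0 i) (cF y)
    (@coord_continuous _ _ _ 0 i (F y))).
have cd : continuous d.
  by move=> y; exact: (cvgB (cFi y) (@coord_continuous _ _ _ 0 i y)).
have dloc (P : set R) : open P -> P (d xi) -> exists e, 0 < e /\
    forall y : 'rV[R]_n.+1, (forall r, `|xi 0 r - y 0 r| < e) -> P (d y).
  move=> oP Pd; have : nbhs xi (d @^-1` P) by apply: cd; exact: open_nbhs_nbhs.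
  move=> /nbhs_ballP[e /= e0 eP]; exists e; split=> // y xiy; apply: eP.
  by split=> // a r; rewrite ord1; exact: xiy.
have nearby (e : R) : 0 < e -> exists u w : 'rV[R]_n.+1,
    [/\ forall r, `|xi 0 r - u 0 r| < e, forall r, `|xi 0 r - w 0 r| < e, d u <= 0 & 0 <= d w].
  move=> e0; have e20 : 0 < e / 2 by rewrite divr_gt0.
  have [N [xiz Ne]] := near_xi _ e20.
  have [_ /(_ i) [u [w [zu zw Fu Fw]]]] := zP N; exists u, w; split.
  - move=> r; rewrite -(subrKA (z N 0 r)) (le_lt_trans (ler_normD _ _))//.
    by rewrite [ltRHS]splitr ltrD// (le_lt_trans (zu r)).
  - move=> r; rewrite -(subrKA (z N 0 r)) (le_lt_trans (ler_normD _ _))//.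
    by rewrite [ltRHS]splitr ltrD// (le_lt_trans (zw r)).
  - by rewrite subr_le0.
  - by rewrite subr_ge0.
apply/eqP; rewrite -subr_eq0 -/(d xi); apply/negPn/negP => dxi.
have [d0|d0|d0] := ltgtP (d xi) 0; last by rewrite d0 eqxx in dxi.
  have [e [e0 eP]] := dloc [set t | t < 0] (@open_lt _ 0) d0.
  by have [u [w [_ /eP/= dw _]]] := nearby e e0; rewrite leNgt dw.
have [e [e0 eP]] := dloc [set t | 0 < t] (@open_gt _ 0) d0.
by have [u [w [/eP/= du _]]] := nearby e e0; rewrite leNgt du.
Qed.

End Brouwer.

(** * Zeros of vector fields pointing outward on a sphere *)

Section RadialRetraction.
Context {R : realType} {V : normedModType R}.
Variables (N : V -> R) (rho : R).
Hypotheses (rho_gt0 : 0 < rho) (N_cont : continuous N).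
Hypothesis N_homo : forall t v, 0 <= t -> N (t *: v) = t * N v.

Definition radial_retraction (v : V) : V := (rho / Num.max rho (N v)) *: v.

Let max_gt0 v : 0 < Num.max rho (N v).
Proof. by rewrite lt_max rho_gt0. Qed.

Lemma radial_retraction_continuous : continuous radial_retraction.
Proof.
move=> v; apply: cvgZ; last exact: cvg_id.
apply: cvgMr; apply: cvgV; first by rewrite gt_eqF.
rewrite maxr_absE; under eq_cvg do rewrite maxr_absE.
apply: cvgMl; apply: cvgD; first by apply: cvgD; [exact: cvg_cst|exact: N_cont].
by apply: cvg_norm; apply: cvgB; [exact: cvg_cst|exact: N_cont].
Qed.

Lemma radial_retraction_le v : N (radial_retraction v) <= rho.
Proof.
rewrite N_homo ?divr_ge0 ?(ltW rho_gt0) ?(ltW (max_gt0 v))//.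
by rewrite mulrAC ler_pdivrMr// ler_pM2l// le_max lexx orbT.
Qed.

Lemma radial_retraction_id v : N v <= rho -> radial_retraction v = v.
Proof.
by move=> vr; rewrite /radial_retraction max_l// divff ?gt_eqF// scale1r.
Qed.

End RadialRetraction.

(** Let r be the radial retraction on the ball N <= rho.  A fixed point v of
    v |-> r (r v - G (r v)) lies in the ball and equals r (v - G v).  Either
    v - G v lies in the ball, so that G v = 0, or v lies on the sphere and
    v - G v is a multiple of v with a factor greater than 1. *)
Lemma outward_field_zero (R : realType) n (N : 'rV[R]_n.+1 -> R)
    (G : 'rV[R]_n.+1 -> 'rV[R]_n.+1) (rho B : R) :
  0 < rho -> continuous N -> (forall t v, 0 <= t -> N (t *: v) = t * N v) ->
  (forall v, N v <= rho -> forall i, `|v 0 i| <= B) ->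
  continuous G ->
  (forall v t, N v = rho -> 0 <= t -> G v <> - (t *: v)) ->
  exists2 v, N v <= rho & G v = 0.
Proof.
move=> rho0 cN hN NB cG out; pose r := radial_retraction N rho.
have cr : continuous r by exact: radial_retraction_continuous.
pose F v := r (r v - G (r v)).
have cF : continuous F.
  move=> v; apply: (cvg_comp (fun v => r v - G (r v)) r _ (cr _)).
  exact: (cvgB (cr v) (cvg_comp r G (cr v) (cG (r v)))).
have FB v i : `|F v 0 i| <= B by apply: NB; exact: radial_retraction_le.
have [v Fv] := brouwer_bounded cF FB.
have Nv : N v <= rho by rewrite -Fv; exact: radial_retraction_le.
exists v => //; rewrite /F (_ : r v = v) in Fv; last exact: radial_retraction_id.
have [Nw|Nw] := leP (N (v - G v)) rho.
  move: Fv; rewrite [r _]radial_retraction_id// => /eqP.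
  by rewrite -subr_eq0 addrAC subrr add0r oppr_eq0 => /eqP.
have Nw0 := lt_trans rho0 Nw; set w := v - G v in Fv Nw Nw0.
have vw : v = (rho / N w) *: w by rewrite -[LHS]Fv /r /radial_retraction max_r// ltW.
have Nv_rho : N v = rho.
  by rewrite vw hN ?divr_ge0 ?(ltW rho0) ?(ltW Nw0)// divfK// gt_eqF.
exfalso; apply: (out v (N w / rho - 1)) => //.
  by rewrite subr_ge0 ler_pdivlMr// mul1r ltW.
have -> : G v = v - w by rewrite /w opprD opprK addrA subrr add0r.
rewrite scalerBl scale1r [RHS]opprB; congr (_ - _).
rewrite [in RHS]vw scalerA (_ : _ * _ = 1) ?scale1r//.
by field; rewrite !gt_eqF.
Qed.

(** * Weak sequential compactness *)

Lemma fmap_ultra (T V : Type) (f : T -> V) (U : set_system T) :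
  UltraFilter U -> UltraFilter (f @ U).
Proof.
move=> UU; have PU : ProperFilter U by exact: ultra_proper.
apply: Build_UltraFilter => G PG UG; apply/seteqP; split; last exact: UG.
move=> A GA; have [//|UnA] := in_ultra_setVsetC (f @^-1` A) UU.
by have [y []] := @filter_ex _ _ PG _ (filterI GA (UG (~` A) UnA)).
Qed.

Section WeakCompactness.
Context {R : realType} {X : normedModType R}.

(** Along U each bounded real function f o u has a limit F(f).  The functional F
    is linear and bounded, so reflexivity represents it by a point. *)
Lemma ultra_weak_limit (T : Type) (U : set_system T) (u : T -> X) (M : R) :
  reflexive_space X -> UltraFilter U -> (forall t, `|u t| <= M) ->
  exists x, forall f : dual X, f (u t) @[t --> U] --> f x.
Proof.
move=> refl UU uM.
have PU : ProperFilter U by exact: ultra_proper.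
have fM (f : dual X) t : `|f (u t)| <= `|f| * M.
  by rewrite (le_trans (dual_normP f _))// ler_wpM2l// dual_norm_ge0.
have lim_ex (f : dual X) : exists l : R^o, f (u t) @[t --> U] --> l.
  have := @segment_compact R (- (`|f| * M)) (`|f| * M).
  rewrite compact_ultra => /(_ _ (fmap_ultra (fun t => f (u t)) UU)).
  case=> [|l [_ fl]]; last by exists l.
  apply: (@filterS _ U _ setT) => [t _ /=|]; last exact: filterT.
  by rewrite in_itv/= -ler_norml.
have [F Ff] := choice lim_ex.
have Flin : linear (F : dual X -> R^o).
  move=> a f g; apply: (cvg_unique _ (Ff (a *: f + g))); first exact: norm_hausdorff.
  by apply: cvgD; [apply: cvgZr; exact: Ff|exact: Ff].
have M0 : 0 <= M.
  have [t _] := @filter_ex _ U PU setT filterT; exact: le_trans (normr_ge0 _) (uM t).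
have Fbound (f : dual X) : `|F f| <= `|f| * M.
  apply: (@closed_cvg _ _ U _ (fun t => `|f (u t)|) [set y | y <= `|f| * M]) => //.
  - apply: nearW => t; exact: fM.
  - exact: cvg_norm.
have Fdual : (F : dual X -> R^o) \in @dual_pred R (dual X).
  apply: asboolT; split=> // f; apply/(@cvgrPdist_le _ _ _ (nbhs f)) => e e0.
  have M1 : 0 < M + 1 by rewrite ltr_wpDl.
  near=> g.
  have -> : F f - F g = F (f - g).
    by have := Flin (-1) g f; rewrite !scaleN1r [_ + f]addrC [_ + F f]addrC => ->.
  apply: le_trans (Fbound _) _; rewrite (@le_trans _ _ (`|f - g| * (M + 1)))//.
    by rewrite ler_wpM2l// lerDl.
  rewrite -ler_pdivlMr//; near: g.
  by apply: cvgr_dist_le; rewrite // divr_gt0.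
have [x xF] := refl (Dual Fdual); exists x => f.
have -> : f x = F f by rewrite -[F f]/(Dual Fdual f) -xF.
exact: Ff.
Unshelve. all: by end_near. Qed.

(** Let x be the weak limit along an ultrafilter.  Countably many functionals
    T_i can be made to converge to T_i x along one subsequence.  If some f did
    not converge to f x along it, a further subsequence would keep f away from
    f x; but its weak limit along the ultrafilter has the same T_i as x, hence
    is x. *)
Lemma reflexive_weak_subsequence (T : nat -> dual X) (u : nat -> X) (M : R) :
  reflexive_space X -> (forall x, (forall i, T i x = 0) -> x = 0) ->
  (forall n, `|u n| <= M) ->
  exists (x : X) (phi : nat -> nat),
    (forall k, (k <= phi k)%N) /\ weak_cvg (u \o phi) x.
Proof.
move=> refl sep uM.
have [U [UU ooU]] := ultraFilterLemma eventually_filter.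
have PU : ProperFilter U by exact: ultra_proper.
have [x xu] := ultra_weak_limit refl UU uM; exists x.
have phi_ex k : exists n, (k <= n)%N /\
    forall i, (i < k)%N -> `|T i x - T i (u n)| < k.+1%:R^-1.
  apply: (@filter_ex _ U); apply: filterI; first by apply: ooU; exists k.
  suff H m : U [set n | forall i, (i < m)%N ->
    `|T i x - T i (u n)| < k.+1%:R^-1] by exact: (H k).
  elim: m => [|m IH]; first by apply: nearW => n i.
  move/cvgrPdist_lt: (xu (T m)) => /(_ k.+1%:R^-1).
  rewrite invr_gt0 ltr0n => /(_ isT) Hm; apply: filterS (filterI IH Hm) => n [h1 h2] i.
  by rewrite ltnS leq_eqVlt => /orP[/eqP ->//|]; exact: h1.
have [phi phiP] := choice phi_ex; exists phi.
split=> [k|f]; first by have [] := phiP k.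
have Tphi i : T i (u (phi k)) @[k --> \oo] --> T i x.
  apply/cvgrPdist_lt => e e0; near=> k.
  have [_ /(_ i) ik] := phiP k; apply: (lt_trans (ik _)).
    by near: k; exists i.+1.
  near: k; exact: near_infty_natSinv_lt (PosNum e0).
apply: contrapT => nf.
have [e e0 bad] : exists2 e : R, 0 < e &
    forall K, exists k, (K <= k)%N /\ e <= `|f x - f (u (phi k))|.
  apply: contrapT => /forall2NP h; apply: nf; apply/cvgrPdist_lt => e e0.
  have [//|/existsNP[K /forallNP hK]] := h e.
  exists K => // k /= Kk; rewrite ltNge; apply/negP => ek; exact: (hK k).
have [psi psiP] := choice bad.
have [x' x'u] := ultra_weak_limit refl UU (fun K => uM (phi (psi K))).
have psi_oo : psi K @[K --> U] --> \oo.
  move=> A [K _ KA]; apply: ooU; exists K => // k /= Kk; apply: KA => /=.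
  by apply: leq_trans Kk _; have [] := psiP k.
have xx' : x' = x.
  apply/eqP; rewrite -subr_eq0; apply/eqP/sep => i; rewrite linearB; apply/eqP.
  rewrite subr_eq0; apply/eqP; apply: (cvg_unique _ (x'u (T i))).
    exact: norm_hausdorff.
  exact: (cvg_comp psi (fun k => T i (u (phi k))) psi_oo (Tphi i)).
move/cvgrPdist_lt: (x'u f) => /(_ e e0); rewrite xx' => /filter_ex[K].
by rewrite ltNge; have [_ ->] := psiP K.
Unshelve. all: by end_near. Qed.

End WeakCompactness.

(** * Coordinate functionals of the basis *)

Section SchauderBasisCoord.
Context {R : realType} {X : normedModType R}.
Variable e : nat -> X.
Hypothesis e_basis : schauder_basis e.

Lemma schauder_coord_expansion x : schauder_expansion e (schauder_coord e x) x.
Proof.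
have [a [ax _]] := e_basis x.
exact: (getPex (ex_intro [set a | schauder_expansion e a x] a ax)).
Qed.

Lemma schauder_coord_unique a x :
  schauder_expansion e a x -> schauder_coord e x = a.
Proof.
have [c [_ cU]] := e_basis x => ax.
by rewrite -(cU _ ax) -(cU _ (@schauder_coord_expansion x)).
Qed.

Lemma schauder_coord_sum n (a : nat -> R) :
  schauder_coord e (\sum_(i < n) a i *: e i) =
  fun i => if (i < n)%N then a i else 0.
Proof.
apply: schauder_coord_unique; rewrite /schauder_expansion.
apply: cvg_near_cst; exists n => // m /= nm.
rewrite /series /= big_mkord (big_ord_widen_cond m predT (fun i => a i *: e i) nm)/=.
rewrite [RHS]big_mkcond; apply: eq_bigr => i _ /=.
by case: ifP => // _; rewrite scale0r.
Qed.

Lemma schauder_coord_basis i : schauder_coord e (e i) = fun j => (j == i)%:R.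
Proof.
have ei : e i = \sum_(j < i.+1) (j == i :> nat)%:R *: e j.
  rewrite big_ord_recr/= eqxx scale1r big1 ?add0r// => j _.
  by rewrite ltn_eqF// scale0r.
rewrite [in LHS]ei (schauder_coord_sum i.+1 (fun j => (j == i)%:R)).
apply: funext => j; case: ifPn => //.
by rewrite ltnS -ltnNge => /gtn_eqF ->.
Qed.

Lemma schauder_basis_neq0 i : e i != 0.
Proof.
apply/eqP => ei; have := schauder_coord_basis i; rewrite ei.
have := schauder_coord_sum 0 (fun=> 0); rewrite big_ord0 => -> /(congr1 (@^~ i)) /=.
by rewrite eqxx => /esym/eqP; rewrite oner_eq0.
Qed.

Lemma schauder_coord_inj0 x : (forall i, schauder_coord e x i = 0) -> x = 0.
Proof.
move=> x0; apply: (cvg_unique _ (@schauder_coord_expansion x)).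
  exact: norm_hausdorff.
apply: cvg_near_cst; apply: nearW => n; rewrite /series /= big1// => i _.
by rewrite x0 scale0r.
Qed.

Variable Psi : X -> dual X.
Hypothesis Psi_def : forall x, x != 0 -> 0 < dual_pairing (Psi x) x.
Hypothesis Psi_proj : forall (F : {fset nat}) (z : X), schauder_span e F z ->
  forall x, dual_pairing (Psi z) (x - schauder_proj e F x) = 0.

(** The coordinate functional e_i^* as an element of the dual; being a multiple
    of Psi (e i), it is continuous by construction. *)
Definition coord_dual i : dual X := (Psi (e i) (e i))^-1 *: Psi (e i).

(** The projection property for the line spanned by e_i evaluates Psi(e_i) at x
    as its value at (e_i^* x) e_i. *)
Lemma coord_dualE i x : coord_dual i x = schauder_coord e x i.
Proof.
have ei0 : Psi (e i) (e i) != 0 by rewrite gt_eqF// Psi_def// schauder_basis_neq0.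
have span_ei : schauder_span e [fset i]%fset (e i).
  by exists (fun=> 1) => //=; rewrite big_seq_fset1 scale1r.
have := Psi_proj span_ei x; rewrite /dual_pairing /schauder_proj big_seq_fset1.
rewrite linearB linearZ => /eqP; rewrite subr_eq0 => /eqP Px.
by rewrite dualZE Px mulrC mulfK.
Qed.

Lemma Psi_coord_dual n (a : nat -> R) x (z := \sum_(i < n) a i *: e i) :
  Psi z x = \sum_(i < n) Psi z (e i) * coord_dual i x.
Proof.
pose F := [fset i in iota 0 n]%fset.
have FE (f : nat -> X) : \sum_(i <- F) f i = \sum_(i < n) f i.
  rewrite -(big_mkord xpredT f) /index_iota subn0; apply: perm_big.
  apply: uniq_perm; rewrite ?iota_uniq ?fset_uniq// => i.
  by rewrite inE.
have span_z : schauder_span e F z by exists a => //=; rewrite FE.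
have := Psi_proj span_z x; rewrite /dual_pairing linearB /= => /eqP.
rewrite subr_eq0 => /eqP ->; rewrite /schauder_proj FE linear_sum.
by apply: eq_bigr => i _; rewrite linearZ -coord_dualE; exact: mulrC.
Qed.

End SchauderBasisCoord.

(** * Galerkin approximations *)

Lemma weakly_continuous_apply (R : realType) (X Y : normedModType R)
    (A : X -> dual Y) (y : Y) :
  weakly_continuous A -> continuous (fun x => A x y).
Proof.
move=> wA x; apply: contrapT => nc.
have [e e0 bad] : exists2 e : R, 0 < e & forall n : nat, exists u : X,
    `|x - u| < n.+1%:R^-1 /\ e <= `|A x y - A u y|.
  apply: contrapT => /forall2NP h; apply: nc; apply/cvgrPdist_lt => e e0.
  have [//|/existsNP[n /forallNP hn]] := h e.
  have : \forall u \near x, `|x - u| < n.+1%:R^-1.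
    by move/cvgrPdist_lt: (@cvg_id _ (nbhs x)); apply; rewrite invr_gt0.
  apply: filterS => u xu; rewrite ltNge; apply/negP => eu; exact: (hn u).
have [u uP] := choice bad.
have ux : u n @[n --> \oo] --> x.
  apply/cvgrPdist_lt => d d0; near=> n; apply: (lt_trans (uP n).1).
  near: n; exact: near_infty_natSinv_lt (PosNum d0).
have wux : weak_cvg u x.
  by move=> f; apply: (cvg_comp u f ux); exact: dual_continuous.
move/cvgrPdist_lt: (wA _ _ wux y) => /(_ e e0) /filter_ex[n].
by rewrite ltNge (uP n).2.
Unshelve. all: by end_near. Qed.

Lemma row_continuous (R : realType) (V : topologicalType) n
    (f : V -> 'I_n -> R) :
  (forall i, continuous (f ^~ i)) ->
  continuous (fun v => \row_i f v i : 'rV[R]_n).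
Proof.
move=> cf v; apply/cvg_ballP => e e0.
have : \forall w \near v, forall i, `|f v i - f w i| < e.
  by apply: filter_forall => i; move/cvgrPdist_lt: (cf i v); exact.
by apply: filterS => w vw; split=> // a i; rewrite !mxE; exact: vw.
Qed.

Section Galerkin.
Context {R : realType} {X Y : normedModType R}.
Variables (e : nat -> X) (A : X -> dual Y) (S : {linear dual X -> Y}).
Variables (Psi : X -> dual X) (b : dual Y).
Hypotheses (e_basis : schauder_basis e) (A_wcont : weakly_continuous A).
Hypothesis data : mapped_coercive_data e A S Psi.

Let T := coord_dual e Psi.

Lemma coercive_radius : exists2 rho : R, 0 < rho &
  forall x, rho <= `|x| -> b (S (Psi x)) < A x (S (Psi x)).
Proof.
have [C C0 PsiC] := Psi_bounded data.
have /linear_bounded_continuous/linear_boundedP/pinfty_ex_gt0[K K0 SK] :=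
  S_continuous data.
have := Phi_coercive data; rewrite limf_einfE => sup_oo.
have : ((`|b| * (K * C))%:E < +oo)%E by exact: ltry.
rewrite -sup_oo => /ereal_sup_gt[_ [V /pinfty_ex_gt0[rho rho0 rhoV] <-] infV].
exists rho => // x rx; have x0 : 0 < `|x| by exact: lt_le_trans rx.
have : ((`|b| * (K * C))%:E < (dual_pairing (A x) (S (Psi x)) / `|x|)%:E)%E.
  apply: lt_le_trans infV _; apply: ereal_inf_lbound; exists x => //.
  exact: rhoV.
rewrite lte_fin ltr_pdivlMr// => Kx; apply: le_lt_trans Kx.
apply: le_trans (ler_norm _) _; apply: le_trans (dual_normP _ _) _.
rewrite -mulrA ler_wpM2l ?dual_norm_ge0// (le_trans (SK _))// -mulrA.
by rewrite ler_wpM2l// ltW.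
Qed.

(** On the sphere of radius rho, G v = - t v with t >= 0 would give
    <A x - b, Phi x> = - t <Psi x, x> <= 0 for the point x with coordinates v,
    by expanding Psi x in the coordinate functionals. *)
Lemma galerkin_solution rho : 0 < rho ->
  (forall x, rho <= `|x| -> b (S (Psi x)) < A x (S (Psi x))) ->
  forall n, exists2 x : X, `|x| <= rho &
    forall i, (i <= n)%N -> A x (S (T i)) = b (S (T i)).
Proof.
move=> rho0 coer n.
(* The coordinates are extended to all indices in nat, as the lemmas on the
   basis take sequences; inord only matters below n.+1. *)
pose a (v : 'rV[R]_n.+1) (i : nat) : R := v 0 (inord i).
pose L (v : 'rV[R]_n.+1) : X := \sum_(i < n.+1) a v i *: e i.
have aE v (i : 'I_n.+1) : a v i = v 0 i by rewrite /a inord_val.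
have Lcoord v (i : 'I_n.+1) : T i (L v) = v 0 i.
  rewrite /T (coord_dualE e_basis (Psi_definite data) (Psi_projection data)).
  by rewrite (schauder_coord_sum e_basis) ltn_ord aE.
have cL : continuous L.
  have := @continuous_big X 'I_n.+1 +%R 0 predT (@add_continuous X) 'rV[R]_n.+1
    (index_enum _) (fun i v => a v i *: e i).
  apply => i _ v.
  exact: (cvgZ (@coord_continuous _ _ _ 0 (inord i) v) (cvg_cst (e i))).
have LZ t v : L (t *: v) = t *: L v.
  by rewrite scaler_sumr; apply: eq_bigr => i _; rewrite /a mxE scalerA.
pose G (v : 'rV[R]_n.+1) : 'rV[R]_n.+1 :=
  \row_i (A (L v) (S (T i)) - b (S (T i))).
have PsiL x v : Psi (L v) x = \sum_(i < n.+1) Psi (L v) (e i) * T i x.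
  exact: (Psi_coord_dual e_basis (Psi_definite data) (Psi_projection data)).
have cG : continuous G.
  apply: row_continuous => i v.
  have AL := cvg_comp L (fun x => A x (S (T i))) (cL v)
    (@weakly_continuous_apply _ _ _ _ (S (T i)) A_wcont (L v)).
  exact: (cvgB AL (cvg_cst (b (S (T i))))).
have [||||v Nv Gv] := @outward_field_zero R n (fun v => `|L v|) G rho
    (\sum_(i < n.+1) `|T i| * rho) rho0 _ _ _ cG.
- by move=> v; exact: (cvg_norm (cL v)).
- by move=> t v t0; rewrite LZ normrZ ger0_norm.
- move=> v Lv i; rewrite -Lcoord (le_trans (dual_normP _ _))//.
  rewrite (le_trans (ler_wpM2l _ Lv)) ?dual_norm_ge0//.
  rewrite (bigD1 i)//= lerDl sumr_ge0// => j _.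
  by rewrite mulr_ge0 ?dual_norm_ge0 ?(ltW rho0).
- move=> v t Lv t0 Gv.
  have SPsi (g : dual Y) : g (S (Psi (L v))) =
      \sum_(i < n.+1) Psi (L v) (e i) * g (S (T i)).
    have PE : Psi (L v) = \sum_(i < n.+1) Psi (L v) (e i) *: T i.
      apply/dual_eqP => x; rewrite PsiL.
      by elim/big_rec2: _ => [|i f r _ ->]; rewrite ?dual0E// dualDE dualZE.
    by rewrite [in LHS]PE !linear_sum; apply: eq_bigr => i _; rewrite !linearZ.
  have := coer (L v); rewrite Lv => /(_ (lexx _)); apply/negP; rewrite -leNgt.
  rewrite -subr_le0 !SPsi -sumrB.
  have -> : \sum_(i < n.+1) (Psi (L v) (e i) * A (L v) (S (T i)) -
      Psi (L v) (e i) * b (S (T i))) = - (t * Psi (L v) (L v)).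
    rewrite PsiL mulr_sumr -sumrN; apply: eq_bigr => i _.
    have := congr1 (fun w : 'rV[R]_n.+1 => w 0 i) Gv; rewrite !mxE => Gvi.
    by rewrite -mulrBr Gvi Lcoord mulrN mulrCA.
  rewrite oppr_le0 mulr_ge0// ltW// (Psi_definite data)//.
  by rewrite -normr_gt0 Lv.
exists (L v) => // i; rewrite -ltnS => ilt; apply/eqP; rewrite -subr_eq0; apply/eqP.
by have := congr1 (fun w : 'rV[R]_n.+1 => w 0 (Ordinal ilt)) Gv; rewrite !mxE.
Qed.

End Galerkin.

(** * Solvability of A(x) = b *)

Theorem theorem2p10 (R : realType) (X Y : completeNormedModType R) (e : nat -> X)
    (A : X -> dual Y) :
  separable_space X -> reflexive_space X ->
  separable_space Y -> reflexive_space Y ->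
  schauder_basis e ->
  strictly_convex (dual X) ->
  weakly_continuous A ->
  mapped_coercive e A ->
  forall b : dual Y, exists x : X, A x = b.
Proof.
move=> _ refl _ _ e_basis _ A_wcont [S [Psi data]] b.
have sep x : (forall i, coord_dual e Psi i x = 0) -> x = 0.
  move=> x0; apply: (schauder_coord_inj0 e_basis) => i.
  by rewrite -(coord_dualE e_basis (Psi_definite data) (Psi_projection data)).
have [rho rho0 coer] := coercive_radius b data.
have gal n : exists x : X, `|x| <= rho /\ forall i, (i <= n)%N ->
    A x (S (coord_dual e Psi i)) = b (S (coord_dual e Psi i)).
  by have [x] := galerkin_solution e_basis A_wcont data rho0 coer n; exists x.
have [u uP] := choice gal.
have [x [phi [phi_ge ux]]] :=
  reflexive_weak_subsequence refl sep (fun n => (uP n).1).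
exists x.
have Ax i : A x (S (coord_dual e Psi i)) = b (S (coord_dual e Psi i)).
  apply: (cvg_unique _ (A_wcont _ _ ux (S (coord_dual e Psi i)))).
    exact: norm_hausdorff.
  apply: cvg_near_cst; exists i => // k /= ik.
  by apply: (uP (phi k)).2; exact: leq_trans (phi_ge k).
have subE y : (A x - b) y = A x y - b y by [].
have cS : continuous S by exact: (S_continuous data).
have H_dual : (fun f : dual X => (A x - b) (S f) : R^o) \in @dual_pred R (dual X).
  apply: asboolT; split=> [a f g|f]; first by rewrite !linearP.
  have := cvg_comp S (dual_fun (A x - b)) (cS f)
    (@dual_continuous _ _ (A x - b) (S f)).
  exact.
have [x0 x0H] := refl (Dual H_dual).
have H_x0 (f : dual X) : f x0 = (A x - b) (S f) by rewrite -[RHS]/(Dual H_dual f) -x0H.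
have x00 : x0 = 0 by apply: sep => i; rewrite H_x0 subE Ax subrr.
apply/dual_eqP => y; have [f <-] := S_surjective data y.
by have := H_x0 f; rewrite x00 linear0 subE => /esym/eqP; rewrite subr_eq0 => /eqP.
Qed.
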